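(* Let $X$ be a locally compact Hausdorff space with a basis of compact open sets, let $A$ be an abelian topological group, and let \[ \Phi_X\colon C_c(X,\mathbb Z)\otimes_{\mathbb Z}A\longrightarrow C_c(X,A),\qquad \Phi_X(f\otimes a)(x)=f(x)\,a, \] be the canonical homomorphism. Then $\Phi_X$ is injective, and the following three conditions on the pair $(X,A)$ are equivalent: (i) every element of $C_c(X,A)$ is locally constant; (ii) the map $\Phi_X$ is surjective; (iii) the map $\Phi_X$ is an isomorphism of abelian groups. In particular, these conditions hold whenever the group $A$ is discrete.
   Context: For a locally compact Hausdorff space $X$ and an abelian topological group $A$ (written additively), $C_c(X,A)$ denotes the abelian group, under pointwise addition, of continuous maps $X\to A$ with compact support, where the support of a map is the closure of the set of points at which it is nonzero. The group $\mathbb Z$ carries the discrete topology. *)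

(* Defs.v *)
From HB Require Import structures.
From mathcomp Require Import all_boot all_order all_algebra.
From mathcomp Require Import freeg.
From mathcomp Require Import all_classical.
From mathcomp Require Import topology tvs.

Set Implicit Arguments.
Unset Strict Implicit.
Unset Printing Implicit Defensive.

Import Order.TTheory GRing.Theory Num.Theory.
Local Open Scope classical_set_scope.
Local Open Scope ring_scope.

HB.instance Definition _ := hasNbhs.Build int principal_filter.
HB.instance Definition _ := Discrete_ofNbhs.Build int erefl.

Lemma int_add_continuous : continuous (fun x : int * int => x.1 + x.2).
Proof.
move=> -[m n] U /=; rewrite nbhs_principalE => /principal_filterP mnU.
exists ([set m], [set n]) => /=; last by move=> [? ?] /= [-> ->].
by split; rewrite nbhs_principalE; apply/principal_filterP.
Qed.

Lemma int_opp_continuous : continuous (-%R : int -> int).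
Proof.
move=> m U /=; rewrite /nbhs /= => /principal_filterP mU.
exact/principal_filterP.
Qed.

HB.instance Definition _ :=
  PreTopologicalNmodule_isTopologicalNmodule.Build int int_add_continuous.
HB.instance Definition _ :=
  TopologicalNmodule_isTopologicalZmodule.Build int int_opp_continuous.

Definition locally_constant (X : topologicalType) (T : Type) (f : X -> T) :=
  forall x : X, \forall y \near x, f y = f x.

Definition zmod_isomorphism (U V : zmodType) (f : {additive U -> V}) :=
  exists g : {additive V -> U}, cancel f g /\ cancel g f.

Section CompactlySupported.
Variables (X : topologicalType) (A : topologicalZmodType).
Implicit Types f g : X -> A.

Definition tsupport f : set X := closure [set x | f x != 0].

Definition cc : {pred X -> A} :=
  mem [set f | continuous f /\ compact (tsupport f)].

Lemma cc_zmod_closed : zmod_closed cc.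
Proof.
split=> [|f g].
  apply/mem_set; split; first exact: cst_continuous.
  rewrite (_ : tsupport _ = set0); first exact: compact0.
  rewrite /tsupport (_ : [set _ | _] = set0) ?closure0//.
  by apply/seteqP; split=> x //=; rewrite eqxx.
move=> /set_mem[fc fK] /set_mem[gc gK]; apply/mem_set; split.
  move=> x; apply: (@continuous_comp _ _ _ (fun x => (f x, g x))
    (fun z : A * A => z.1 - z.2)); last exact: sub_continuous.
  by apply: cvg_pair; [exact: fc|exact: gc].
apply: (subclosed_compact _ (compactU fK gK)); first exact: closed_closure.
rewrite /tsupport -closureU; apply: closureS => x /= fgx.
have [fx0|] := eqVneq (f x) 0; last by left.
by right; apply: contraNneq fgx => gx0; rewrite !fctE fx0 gx0 subr0.
Qed.

HB.instance Definition _ := GRing.isZmodClosed.Build (X -> A) cc cc_zmod_closed.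

Record ccType := CcFun { cc_fun :> X -> A ; cc_funP : cc_fun \in cc }.

HB.instance Definition _ := [isSub for cc_fun].
HB.instance Definition _ := [Choice of ccType by <:].
HB.instance Definition _ := [SubChoice_isSubZmodule of ccType by <:].

End CompactlySupported.
Arguments cc : clear implicits.
Arguments ccType : clear implicits.

Notation "'C_c(' X , A )" := (ccType X A)
  (format "'C_c(' X ,  A )") : type_scope.

(* M (x) N as the free abelian group on M * N modulo the subgroup generated by
   the biadditivity relations; the library provides no tensor product. *)
Section TensorProduct.
Variables M N : zmodType.

(* Over the base ring Z, biadditivity already forces
   (m *~ k, n) and (m, n *~ k) to be identified for all k : int. *)
Definition tensor_relation : set {freeg (M * N) / int} :=
  [set r | (exists m m' n, r = << (m + m', n) >> - << (m, n) >> - << (m', n) >>)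
        \/ (exists m n n', r = << (m, n + n') >> - << (m, n) >> - << (m, n') >>)].

Definition tensor_relator : {pred {freeg (M * N) / int}} :=
  mem [set z | forall S : set {freeg (M * N) / int},
    S 0 -> (forall x y, S x -> S y -> S (x - y)) ->
    tensor_relation `<=` S -> S z].

Lemma tensor_relator_zmod_closed : zmod_closed tensor_relator.
Proof.
split=> [|x y]; first by apply/mem_set => S S0 _ _.
move=> /set_mem xR /set_mem yR; apply/mem_set => S S0 SB SR.
by apply: (SB); [exact: xR|exact: yR].
Qed.

HB.instance Definition _ :=
  GRing.isZmodClosed.Build _ tensor_relator tensor_relator_zmod_closed.

Definition tensor : Type := Quotient.quot tensor_relator.

HB.instance Definition _ := GRing.Zmodule.on tensor.

Definition tensor_class (z : {freeg (M * N) / int}) : tensor :=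
  \pi_(Quotient.quot tensor_relator)%qT z.

Definition tens (m : M) (n : N) : tensor := tensor_class << (m, n) >>.

Lemma tensor_classB : {morph tensor_class : x y / x - y}.
Proof. by move=> x y; rewrite /tensor_class -pi_oppr -pi_addr. Qed.

Lemma tensor_class0 : tensor_class 0 = 0.
Proof. by have := tensor_classB 0 0; rewrite !subrr. Qed.

Lemma tensor_class_repr (t : tensor) :
  tensor_class (repr (t : Quotient.quot tensor_relator)) = t.
Proof. exact: reprK. Qed.

Lemma tensor_class_eqP x y :
  tensor_class x = tensor_class y <-> x - y \in tensor_relator.
Proof. by rewrite Quotient.idealrBE; split=> [xy|/eqP//]; apply/eqP. Qed.

Lemma tensDl m m' n : tens (m + m') n = tens m n + tens m' n.
Proof.
apply/eqP; rewrite -subr_eq0 opprD addrA -!tensor_classB; apply/eqP.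
rewrite -tensor_class0; apply/tensor_class_eqP; rewrite subr0; apply/mem_set => S _ _; apply; left.
by exists m, m', n.
Qed.

Lemma tensDr m n n' : tens m (n + n') = tens m n + tens m n'.
Proof.
apply/eqP; rewrite -subr_eq0 opprD addrA -!tensor_classB; apply/eqP.
rewrite -tensor_class0; apply/tensor_class_eqP; rewrite subr0; apply/mem_set => S _ _; apply; right.
by exists m, n, n'.
Qed.

Lemma tensor_ind (S : set tensor) :
  S 0 -> (forall t u, S t -> S u -> S (t - u)) ->
  (forall m n, S (tens m n)) -> forall t, S t.
Proof.
move=> S0 SB St t.
have SN u : S u -> S (- u) by rewrite -sub0r; exact: SB.
have SD u v : S u -> S v -> S (u + v).
  by move=> Su Sv; rewrite -[v]opprK; apply: (SB) => //; exact: SN.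
have c0 := tensor_class0.
have cN z : tensor_class (- z) = - tensor_class z.
  by rewrite -sub0r tensor_classB c0 sub0r.
have cD z z' : tensor_class (z + z') = tensor_class z + tensor_class z'.
  by rewrite -[z' in LHS]opprK tensor_classB cN opprK.
have Snat k m n : S (tensor_class << k%:Z *g (m, n) >>).
  elim: k => [|k IH]; first by rewrite freegU0 c0.
  by rewrite -addn1 PoszD -freegUD cD; apply: SD => //; exact: St.
rewrite -(tensor_class_repr t) -[repr _]freeg_sumE.
elim/big_rec : _ => [|[m n] z _ Sz]; first by rewrite c0.
rewrite cD; apply: SD => //.
case: (intP (coeff _ _)) => [|k|k]; first exact: (Snat 0%N).
  exact: (Snat k.+1).
by rewrite -freegUN cN; apply: SN; exact: (Snat k.+1).
Qed.

Section Lift.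
Variables (P : zmodType) (b : M -> N -> P).

Definition biadditive :=
  (forall m m' n, b (m + m') n = b m n + b m' n) /\
  (forall m n n', b m (n + n') = b m n + b m n').

Definition free_lift : {freeg (M * N) / int} -> P :=
  @fglift int (zmodule P) _ (fun mn => b mn.1 mn.2).

Lemma free_liftB : {morph free_lift : x y / x - y}.
Proof. exact: (@lift_is_additive int _ (zmodule P)). Qed.

Lemma free_liftU m n : free_lift << (m, n) >> = b m n.
Proof. by rewrite /free_lift liftU scale1r. Qed.

(* Meaningful for biadditive b only: it evaluates the free extension of b at a
   chosen representative of the class. *)
Definition tensor_lift (t : tensor) : P :=
  free_lift (repr (t : Quotient.quot tensor_relator)).

Hypothesis bP : biadditive.

Lemma free_lift_relator z : z \in tensor_relator -> free_lift z = 0.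
Proof.
move=> /set_mem /(_ [set z | free_lift z = 0]); apply => /=.
- by have := free_liftB 0 0; rewrite !subrr.
- by move=> x y x0 y0; rewrite free_liftB x0 y0 subrr.
- move=> r /= [[m [m' [n ->]]]|[m [n [n' ->]]]];
    rewrite !free_liftB !free_liftU.
  + by rewrite bP.1 addrAC addrK subrr.
  + by rewrite bP.2 addrAC addrK subrr.
Qed.

Lemma tensor_lift_class z : tensor_lift (tensor_class z) = free_lift z.
Proof.
apply/eqP; rewrite -subr_eq0 -free_liftB free_lift_relator//.
by apply/tensor_class_eqP; rewrite tensor_class_repr.
Qed.

Lemma tensor_liftE m n : tensor_lift (tens m n) = b m n.
Proof. by rewrite tensor_lift_class free_liftU. Qed.

Lemma tensor_liftB : {morph tensor_lift : t u / t - u}.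
Proof.
move=> t u; rewrite -[t in LHS]tensor_class_repr -[u in LHS]tensor_class_repr.
by rewrite -tensor_classB tensor_lift_class free_liftB.
Qed.

End Lift.
End TensorProduct.

Section CanonicalMap.
Variables (X : topologicalType) (A : topologicalZmodType).

Lemma mulrz_cc (f : C_c(X, int)) (a : A) : (fun x => a *~ f x) \in cc X A.
Proof.
have [fc fK] := set_mem (cc_funP f).
apply/mem_set; split.
  move=> x U /nbhs_singleton Ux.
  have fx : nbhs (f x) [set f x].
    by rewrite nbhs_principalE; exact/principal_filterP.
  have fxx : \forall y \near x, f y = f x := fc x _ fx.
  suff : \forall y \near x, U (a *~ f y) by [].
  by apply: filterS fxx => y ->.
apply: (subclosed_compact _ fK); first exact: closed_closure.
apply: closureS => x /=; apply: contraNneq => ->.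
by rewrite mulr0z.
Qed.

Definition Phi_pair (f : C_c(X, int)) (a : A) : C_c(X, A) :=
  CcFun (mulrz_cc f a).

Lemma Phi_pair_biadditive : biadditive Phi_pair.
Proof.
split=> [f g a|f a a']; apply/val_inj/funext => x /=.
  exact: mulrzDr.
exact: mulrzDl.
Qed.

Definition Phi : tensor C_c(X, int) A -> C_c(X, A) := tensor_lift Phi_pair.

HB.instance Definition _ :=
  GRing.isZmodMorphism.Build _ _ Phi (tensor_liftB Phi_pair_biadditive).

Lemma PhiE (f : C_c(X, int)) (a : A) x : Phi (tens f a) x = a *~ f x.
Proof. by rewrite /Phi tensor_liftE//; exact: Phi_pair_biadditive. Qed.

End CanonicalMap.
Arguments Phi : clear implicits.

(* Main.v *)
Require Import Defs.
From HB Require Import structures.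
From mathcomp Require Import all_boot all_order all_algebra.
From mathcomp Require Import all_classical.
From mathcomp Require Import topology tvs.

(** A locally constant function with compact support is the same thing as a
finite amount of data: it takes finitely many nonzero values, each of them on a
compact open level set, and it is the sum of its nonzero values times the
indicators of the corresponding level sets ([level_decomposition]).

Surjectivity of Phi onto the locally constant functions is exactly this
decomposition: if [v] runs over the nonzero values of [f] and [1_v] is the
indicator of the set where [f] equals [v], then [f] is the image of the sum of
the tensors [1_v (x) v]. Conversely an element of the tensor product is a finite
sum of pure tensors [f_i (x) a_i], and its image [x |-> sum_i f_i(x) a_i]
factors through the joint map [h = (f_1, ..., f_n)], which is locally constant
because the integers are discrete. So the image of Phi is the set of locally
constant elements, which is the equivalence of (i) and (ii).

Injectivity uses the level sets of the same joint map [h]. Writing each [f_i] as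
the sum over the nonzero values [v] of [h] of [v_i 1_v], and moving the integers
[v_i] across the tensor sign, one gets
[sum_i f_i (x) a_i = sum_v 1_v (x) (sum_i v_i a_i)]. The level sets are now
pairwise disjoint, so the coefficient [sum_i v_i a_i] is the value of the image
at any point of the level set of [v]. If the image is zero, then for each [v]
either this coefficient vanishes or the level set is empty and [1_v = 0]; in
both cases the term is zero. *)

Local Open Scope classical_set_scope.
Local Open Scope ring_scope.

Set Implicit Arguments.
Unset Strict Implicit.
Import GRing.Theory.

(** * Locally constant functions *)

Section LocallyConstant.
Variable X : topologicalType.

Lemma locally_constant_comp (T U : Type) (c : T -> U) (h : X -> T) :
  locally_constant h -> locally_constant (c \o h).
Proof. by move=> hlc x; apply: filterS (hlc x) => y /= ->. Qed.

Lemma locally_constant_ffun (I : finType) (T : Type) (f : I -> X -> T) :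
  (forall i, locally_constant (f i)) ->
  locally_constant (fun x => [ffun i => f i x]).
Proof.
move=> flc x; have : \forall y \near x, forall i, f i y = f i x.
  by apply: filter_forall => i; exact: flc.
by apply: filterS => y fyx; apply/ffunP => i; rewrite !ffunE.
Qed.

Lemma locally_constant_continuous (T : topologicalType) (h : X -> T) :
  locally_constant h -> continuous h.
Proof.
move=> hlc x U /nbhs_singleton Ux.
suff : \forall y \near x, U (h y) by [].
by apply: filterS (hlc x) => y ->.
Qed.

Lemma continuous_locally_constant (T : topologicalType) (h : X -> T) :
  (forall U : set T, open U) -> continuous h -> locally_constant h.
Proof.
move=> Topen hc x; apply: (hc x [set h x]).
exact: open_nbhs_nbhs.
Qed.

(** A point in the closure of a level set has a neighbourhood on which [h] is
constant, and that neighbourhood meets the level set. *)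
Lemma locally_constant_level_closed (T : Type) (h : X -> T) (v : T) :
  locally_constant h -> closed [set x | h x = v].
Proof. by move=> hlc x /(_ _ (hlc x)) [y [/= <-]]. Qed.

(** A compact set is covered by finitely many of the open sets on which [h] is
constant. *)
Lemma compact_locally_constant_finite (T : eqType) (h : X -> T) (K : set X) :
  locally_constant h -> compact K ->
  exists s : seq T, forall x, K x -> h x \in s.
Proof.
move=> hlc /compact_near_coveringP Kcov.
(* Compactness is used in its near-covering form, along the filter of all
   sufficiently large finite lists of values: near each [x], every list that
   contains [h x] contains the values of [h]. *)
pose F := filter_from [set: seq T]
  (fun s => [set s' : seq T | {subset s <= s'}]).
have Ffilter : Filter F.
  apply: filter_from_filter; first by exists [::].
  move=> s s' _ _; exists (s ++ s') => // s'' /= sub.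
  by split=> v vs; apply: sub; rewrite mem_cat vs ?orbT.
have [|s _ /(_ s (fun _ => id)) hs] := Kcov _ F (fun s x => h x \in s) Ffilter.
  move=> x Kx; exists ([set y | h y = h x], [set s | h x \in s]).
    split; first exact: hlc.
    by exists [:: h x] => // s /=; apply; rewrite mem_head.
  by case=> y s /= [-> ].
by exists s.
Qed.

End LocallyConstant.

(** * Decomposition along level sets *)

Section Levels.
Variables (X : topologicalType) (T : choiceType).
Implicit Types (h : X -> T) (v : T).

(** The indicator of a level set as an element of [C_c(X, int)]; outside the
case where this indicator is continuous with compact support, it is the junk
value 0. *)
Definition level h v : C_c(X, int) := insubd 0 (fun x => (h x == v)%:Z).

Lemma levelE h (K : set X) v : locally_constant h -> compact K ->
  (forall x, h x = v -> K x) -> forall x, level h v x = (h x == v)%:Z.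
Proof.
move=> hlc Kc hK x; suff hcc : (fun x => (h x == v)%:Z) \in cc X int.
  by rewrite /level [_ x](congr1 (@^~ x) (insubdK 0 hcc)).
apply/mem_set; split.
  apply: locally_constant_continuous.
  exact: (locally_constant_comp (fun t => (t == v)%:Z) hlc).
have -> : tsupport (fun x => (h x == v)%:Z : int) = [set x | h x = v].
  have := locally_constant_level_closed (v := v) hlc => /closure_id ->.
  rewrite /tsupport; congr closure; apply/seteqP.
  by split=> y /=; case: (h y =P v).
exact: subclosed_compact (locally_constant_level_closed (v := v) hlc) Kc hK.
Qed.

(** The finite list [s] of values serves all [c] at once, with [d] playing the
part of zero. Surjectivity of Phi takes [c] to be the identity, and its
injectivity takes for [c] the coordinates of a tuple of functions. *)
Lemma level_decomposition h (K : set X) d : locally_constant h -> compact K ->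
  (forall x, h x <> d -> K x) ->
  exists s : seq T,
    (forall v x, v \in s -> level h v x = (h x == v)%:Z) /\
    forall (G : zmodType) (c : T -> G), c d = 0 ->
      forall x, c (h x) = \sum_(v <- s) c v *~ level h v x.
Proof.
move=> hlc Kc hK; have [s hs] := compact_locally_constant_finite hlc Kc.
(* The value [d] is left out because its level set need not be compact. *)
pose s' := [seq v <- undup s | v != d].
have s'E v x : v \in s' -> level h v x = (h x == v)%:Z.
  rewrite mem_filter => /andP[/eqP vd _].
  by apply: (levelE hlc Kc) => y hy; apply: hK; rewrite hy.
exists s'; split=> // G c cd x.
rewrite [RHS](eq_big_seq (fun v => if v == h x then c v else 0)); last first.
  by move=> v /s'E ->; rewrite eq_sym; case: eqP; rewrite ?mulr1z ?mulr0z.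
have [hd|hd] := eqVneq (h x) d.
  rewrite hd cd big_seq big1// => v.
  by rewrite mem_filter => /andP[/negPf ->].
have hxs : h x \in s'.
  by rewrite mem_filter hd mem_undup hs//; apply: hK; exact/eqP.
rewrite (bigD1_seq (h x))//= ?filter_uniq ?undup_uniq// eqxx.
by rewrite big1 ?addr0// => v /negPf ->.
Qed.

End Levels.

(** * Finite sums of pure tensors *)

Section TensorAdditivity.
Variables M N : zmodType.

(** The two partial applications of [tens] are named so that they can carry the
structure of additive maps. *)
Definition tensl (n : N) (m : M) : tensor M N := tens m n.
Definition tensr (m : M) (n : N) : tensor M N := tens m n.

Lemma tensl_is_zmod_morphism n : {morph tensl n : x y / x - y}.
Proof.
by move=> x y; apply/eqP; rewrite eq_sym subr_eq /tensl -tensDl subrK.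
Qed.

Lemma tensr_is_zmod_morphism m : {morph tensr m : x y / x - y}.
Proof.
by move=> x y; apply/eqP; rewrite eq_sym subr_eq /tensr -tensDr subrK.
Qed.

HB.instance Definition _ n :=
  GRing.isZmodMorphism.Build M (tensor M N) (tensl n)
    (tensl_is_zmod_morphism n).
HB.instance Definition _ m :=
  GRing.isZmodMorphism.Build N (tensor M N) (tensr m)
    (tensr_is_zmod_morphism m).

Lemma tens_mulrzl (m : M) (n : N) (k : int) : tens (m *~ k) n = tens m (n *~ k).
Proof. by rewrite -[LHS]/(tensl n _) -[RHS]/(tensr m _) !raddfMz. Qed.

Lemma tensor_sum_tens (t : tensor M N) :
  exists s : seq (M * N), t = \sum_(p <- s) tens p.1 p.2.
Proof.
move: t; apply: tensor_ind => [|_ _ [s ->] [s' ->]|m n] /=.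
- by exists [::]; rewrite big_nil.
- exists (s ++ [seq (- p.1, p.2) | p <- s']).
  rewrite big_cat big_map/=; congr (_ + _); rewrite -sumrN.
  by apply: eq_bigr => p _; exact/esym/(raddfN (tensl p.2)).
- by exists [:: (m, n)]; rewrite big_seq1.
Qed.

End TensorAdditivity.

(** * The canonical map *)

Lemma bij_zmod_isomorphism (U V : zmodType) (f : {additive U -> V}) :
  injective f -> (forall v, exists u, f u = v) -> zmod_isomorphism f.
Proof.
move=> finj fsurj; pose g v := projT1 (cid (fsurj v)).
have gK : cancel g f by move=> v; rewrite /g; case: cid.
have gB : {morph g : x y / x - y}.
  by move=> x y; apply: finj; rewrite raddfB !gK.
pose G : {additive V -> U} :=
  HB.pack g (GRing.isZmodMorphism.Build V U g gB).
by exists G; split=> // u; apply: finj; exact: gK.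
Qed.

Section PhiProperties.
Variables (X : topologicalType) (A : topologicalZmodType).

Lemma tsupport_compact (B : topologicalZmodType) (f : C_c(X, B)) :
  compact (tsupport f).
Proof. by have [] := set_mem (cc_funP f). Qed.

Lemma tsupport_neq0 (B : topologicalZmodType) (f : X -> B) x :
  f x <> 0 -> tsupport f x.
Proof. by move=> /eqP fx; apply: subset_closure. Qed.

Lemma int_locally_constant (f : C_c(X, int)) : locally_constant f.
Proof.
have [fc _] := set_mem (cc_funP f).
by apply: continuous_locally_constant fc => U; exact: discrete_open.
Qed.

(** Evaluation at a point is named so that it can carry the structure of an
additive map. *)
Definition ev (B : topologicalZmodType) (x : X) (f : C_c(X, B)) : B := f x.

Lemma ev_is_zmod_morphism (B : topologicalZmodType) x :
  {morph @ev B x : f g / f - g}.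
Proof. by []. Qed.

HB.instance Definition _ (B : topologicalZmodType) x :=
  GRing.isZmodMorphism.Build C_c(X, B) B (@ev B x) (@ev_is_zmod_morphism B x).

Lemma cc_sumE (B : topologicalZmodType) (I : Type) (s : seq I)
    (f : I -> C_c(X, B)) x : (\sum_(i <- s) f i) x = \sum_(i <- s) f i x.
Proof. exact: (raddf_sum (ev x)). Qed.

Lemma cc_mulrzE (B : topologicalZmodType) (f : C_c(X, B)) (k : int) x :
  (f *~ k) x = f x *~ k.
Proof. exact: (raddfMz (ev x) k f). Qed.

Lemma Phi_sumE (I : Type) (s : seq I) (f : I -> C_c(X, int)) (a : I -> A) x :
  Phi X A (\sum_(i <- s) tens (f i) (a i)) x = \sum_(i <- s) a i *~ f i x.
Proof.
by rewrite raddf_sum cc_sumE; apply: eq_bigr => i _; rewrite PhiE.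
Qed.

(** On a neighbourhood where each of the finitely many integer-valued factors of
[t] is constant, so is the image of [t]. *)
Lemma Phi_locally_constant t : locally_constant (Phi X A t).
Proof.
have [s ->] := tensor_sum_tens t => x; rewrite (big_nth (0, 0)) big_mkord.
have flc (i : 'I_(size s)) : locally_constant (nth (0, 0) s i).1.
  exact: int_locally_constant.
apply: filterS (locally_constant_ffun flc x) => y /ffunP fyx.
rewrite !Phi_sumE; apply: eq_bigr => i _.
by have := fyx i; rewrite !ffunE => ->.
Qed.

(** The preimage is the sum of the tensors [1_v (x) v] over the nonzero values
[v] of [f]. *)
Lemma locally_constant_Phi (f : C_c(X, A)) :
  locally_constant f -> exists t, Phi X A t = f.
Proof.
move=> flc.
have fsupp x : f x <> 0 -> tsupport f x by exact: tsupport_neq0.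
have [s [_ sE]] := level_decomposition flc (@tsupport_compact _ f) fsupp.
exists (\sum_(v <- s) tens (level f v) v).
by apply/val_inj/funext => x /=; rewrite Phi_sumE (sE _ id).
Qed.

(** Splitting the integer-valued factors of a tensor along the level sets of
their joint map rewrites it with pairwise disjoint indicators; the coefficients
can then be read off from the values of its image. *)
Lemma Phi_inj : injective (Phi X A).
Proof.
apply: raddf_inj => t; have [r ->] := tensor_sum_tens t.
rewrite (big_nth (0, 0)) big_mkord.
set n := size r; pose f (i : 'I_n) := (nth (0, 0) r i).1.
pose a (i : 'I_n) := (nth (0, 0) r i).2.
rewrite -/(\sum_(i < n) tens (f i) (a i)) => Phi0.
pose h x := [ffun i => f i x].
have hlc : locally_constant h.
  by apply: locally_constant_ffun => i; exact: int_locally_constant.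
pose K := \big[setU/set0]_(i < n) tsupport (f i).
have Kc : compact K by apply: bigsetU_compact => i _; exact: tsupport_compact.
have hK x : h x <> [ffun=> 0] -> K x.
  move=> hx; apply: contrapT => Kx; apply: hx; apply/ffunP => i; rewrite !ffunE.
  apply: contrapT => fx; apply: Kx; rewrite /K (bigD1 i)//=; left.
  exact: tsupport_neq0.
have [s [levE sE]] := level_decomposition hlc Kc hK.
have fE i : f i = \sum_(v <- s) level h v *~ v i.
  apply/val_inj/funext => x /=; rewrite cc_sumE.
  have := sE _ (fun v : {ffun 'I_n -> int} => v i).
  rewrite ffunE => /(_ erefl x); rewrite ffunE => ->.
  by apply: eq_bigr => v _; rewrite cc_mulrzE !mulrzz mulrC.
(* Move the integers [v i] to the right factor and collect by level set. *)
have -> : \sum_(i < n) tens (f i) (a i) =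
    \sum_(v <- s) tens (level h v) (\sum_(i < n) a i *~ v i).
  under [RHS]eq_bigr => v _ do rewrite -[tens _ _]/(tensr _ _) raddf_sum.
  rewrite exchange_big/=; apply: eq_bigr => i _.
  rewrite {1}fE -[LHS]/(tensl _ _) raddf_sum/=; apply: eq_bigr => v _.
  exact: tens_mulrzl.
rewrite big_seq big1// => v vs.
(* At a point of the level set of [v], the image of the tensor is the
   coefficient; an empty level set has zero indicator instead. *)
have [[x hx]|/forallNP hv] := pselect (exists x, h x = v).
  rewrite (_ : \sum_(i < n) _ = 0); first exact: (raddf0 (tensr _)).
  transitivity (\sum_(i < n) a i *~ f i x); last by rewrite -Phi_sumE Phi0.
  by rewrite -hx; apply: eq_bigr => i _; rewrite ffunE.
rewrite (_ : level h v = 0); first exact: (raddf0 (tensl _)).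
apply/val_inj/funext => x /=; rewrite levE//.
by case: eqP => // hx; have := hv x.
Qed.

End PhiProperties.

Theorem theorem1p1 (X : topologicalType) (A : topologicalZmodType)
  (X_locally_compact : locally_compact [set: X])
  (X_hausdorff : hausdorff_space X)
  (X_basis : exists2 B : set (set X), basis B & forall U, B U -> compact U) :
  let all_loc_cst := forall f : C_c(X, A), locally_constant f in
  let Phi_surjective := forall f : C_c(X, A), exists t, Phi X A t = f in
  let Phi_isomorphism := zmod_isomorphism (Phi X A) in
  [/\ injective (Phi X A),
      (all_loc_cst <-> Phi_surjective),
      (Phi_surjective <-> Phi_isomorphism)
    & (forall U : set A, open U) ->
        [/\ all_loc_cst, Phi_surjective & Phi_isomorphism]].
Proof.
move=> all_loc_cst Phi_surjective Phi_isomorphism.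
have lc_surj : all_loc_cst -> Phi_surjective.
  by move=> lc f; exact: locally_constant_Phi.
have surj_iso : Phi_surjective -> Phi_isomorphism.
  by move=> surj; apply: bij_zmod_isomorphism surj; exact: Phi_inj.
split; first exact: Phi_inj.
- split=> // surj f; have [t <-] := surj f; exact: Phi_locally_constant.
- by split=> [|[g [_ gK]] f]; [exact: surj_iso|exists (g f); exact: gK].
- move=> Aopen; have lc : all_loc_cst.
    move=> f; have [fc _] := set_mem (cc_funP f).
    exact: continuous_locally_constant.
  have surj := lc_surj lc; split=> //; exact: surj_iso.
Qed.
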